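(* Let $\alpha\in(0,1)$, let $d\ge 1$ be an integer, and let $g:\mathbb{R}^d\to\mathbb{R}^d$ be globally Lipschitz continuous. For $f\in\mathfrak{C}$ let $x_f\in\mathfrak{C}$ be the solution of $$x_f(t)=f(t)+\int_0^t a(t,s)\,g(x_f(s))\,ds,\qquad t\in\mathbb{R}^+,$$ and for $\tau\in\mathbb{R}^+$ define $$(T_\tau f)(\theta)=f(\tau+\theta)+\int_0^\tau a(\tau+\theta,s)\,g(x_f(s))\,ds,\qquad \theta\in\mathbb{R}^+.$$ Then $\{T_\tau:\tau\in\mathbb{R}^+\}$ is a semi-group of continuous operators on $\mathfrak{C}$; that is, each $T_\tau$ is a continuous map $\mathfrak{C}\to\mathfrak{C}$, $T_0$ is the identity, and $T_{\sigma+\tau}f=T_\sigma(T_\tau f)$ for all $\sigma,\tau\ge 0$ and all $f\in\mathfrak{C}$.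
   Context: $\mathbb{R}^+=[0,\infty)$. $\mathfrak{C}$ is the space of continuous functions $f:\mathbb{R}^+\to\mathbb{R}^d$ with the topology of uniform convergence on compact subsets, which is induced by the metric $$\rho(f,h)=\sum_{n=1}^\infty \frac{1}{2^n}\rho_n(f,h),\qquad \rho_n(f,h)=\frac{\sup_{t\in[0,n]}\|f(t)-h(t)\|}{1+\sup_{t\in[0,n]}\|f(t)-h(t)\|}.$$ The kernel is $$a(t,s)=\frac{1}{\Gamma(\alpha)}(t-s)^{\alpha-1},\qquad 0\le s<t,$$ where $\Gamma(\alpha)=\int_0^\infty t^{\alpha-1}e^{-t}\,dt$ is the Gamma function. Under the global Lipschitz condition on $g$, for each $f\in\mathfrak{C}$ the integral equation defining $x_f$ has a unique continuous solution on every interval $[0,T]$, $T>0$, hence on $\mathbb{R}^+$. (For constant $f\equiv x_0$ the integral equation is the integral form of the autonomous Caputo fractional differential equation ${}^{C}D^{\alpha}_{0+}x(t)=g(x(t))$, $x(0)=x_0$.) *)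

(* Defs.v *)
From HB Require Import structures.
From mathcomp Require Import all_boot all_order all_algebra.
From mathcomp Require Import all_classical all_reals all_analysis.

Set Implicit Arguments.
Unset Strict Implicit.
Unset Printing Implicit Defensive.

Import Order.TTheory GRing.Theory Num.Theory.
Import numFieldNormedType.Exports.

Local Open Scope classical_set_scope.
Local Open Scope ring_scope.

Definition Rplus (R : realType) : set R := [set t | 0 <= t].
Arguments Rplus R : clear implicits.

Definition cts_paths (R : realType) (d : nat) : Type :=
  continuousType (Rplus R) 'rV[R]_d.

(* [continuousType] carries no canonical topology. The one chosen here is that
   of uniform convergence on the compact subsets of the half-line. *)
HB.instance Definition _ (R : realType) (d : nat) :=
  Topological.copy (cts_paths R d)
    (initial_topology (fun f : continuousType (Rplus R) 'rV[R]_d =>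
       (f : Rplus R -> 'rV[R]_d) : {family compact, Rplus R -> 'rV[R]_d})).

(* [valL f] extends [f] to the negative reals by a default value; it is only ever
   evaluated at nonnegative times. *)
Definition path_at (R : realType) (d : nat) (f : cts_paths R d) (t : R) :
    'rV[R]_d :=
  valL (f : Rplus R -> 'rV[R]_d) t.

Definition Gamma (R : realType) (alpha : R) : R :=
  (\int[lebesgue_measure]_(t in `]0%R, +oo[) (t `^ (alpha - 1) * expR (- t)))%R.

Definition frac_kernel (R : realType) (alpha t s : R) : R :=
  (Gamma alpha)^-1 * (t - s) `^ (alpha - 1).

(* The integral over [0, tau[ of frac_kernel alpha t s *: g (x s), for tau <= t,
   computed coordinatewise. The endpoint tau is left out because the kernel is
   only meant for s < t. *)
Definition memory (R : realType) (d : nat) (alpha : R)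
    (g : 'rV[R]_d -> 'rV[R]_d) (x : cts_paths R d) (t tau : R) : 'rV[R]_d :=
  \row_(i < d) (\int[lebesgue_measure]_(s in `[0%R, tau[)
                  (frac_kernel alpha t s * g (path_at x s) 0 i))%R.

Definition is_solution (R : realType) (d : nat) (alpha : R)
    (g : 'rV[R]_d -> 'rV[R]_d) (f x : cts_paths R d) : Prop :=
  forall t : R, 0 <= t -> path_at x t = path_at f t + memory alpha g x t t.

(* The default value [f] of [xget] is irrelevant: for 0 < alpha < 1 and g
   Lipschitz there is exactly one solution. *)
Definition solution (R : realType) (d : nat) (alpha : R)
    (g : 'rV[R]_d -> 'rV[R]_d) (f : cts_paths R d) : cts_paths R d :=
  xget f [set x | is_solution alpha g f x].

(* (T_tau f)(theta), before it is known to be continuous in theta. *)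
Definition translate (R : realType) (d : nat) (alpha : R)
    (g : 'rV[R]_d -> 'rV[R]_d) (tau : R) (f : cts_paths R d) (theta : R) :
    'rV[R]_d :=
  path_at f (tau + theta)
  + memory alpha g (solution alpha g f) (tau + theta) tau.

(* Main.v *)
From HB Require Import structures.
Require Import Defs.
From mathcomp Require Import all_boot all_order all_algebra.
From mathcomp Require Import all_classical all_reals all_analysis.
From mathcomp Require Import measurable_realfun ring lra.

Set Implicit Arguments.
Unset Strict Implicit.
Unset Printing Implicit Defensive.

Import Order.TTheory GRing.Theory Num.Theory.
Import numFieldNormedType.Exports.

Local Open Scope classical_set_scope.
Local Open Scope ring_scope.

(** The kernel has the difference form k (t - s), with k integrable on every
    interval ]0, N] because alpha > 0 ([integrable_powR]). The substitution
    u = t - s turns the integral over [0, tau[ of k (t - s) y(s) into a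
    convolution of k with y cut off to [0, tau[ ([volterra_convolution]). In that
    form the integral depends continuously on t, by dominated convergence,
    although the singularity of the kernel moves with t
    ([convolution_continuous]); and splitting the cut-off at tau gives the shift
    identity ([volterra_shift]).

    The integral equation is treated with exponential weights. Since the
    integral over ]0, N] of |k u| exp(- lam u) tends to 0 as lam grows
    ([weighted_mass_small]), on [0, N] the integral operator halves distances
    measured with the weight exp(- lam t), for some lam ([volterra_contraction]).
    From this single estimate come the Lipschitz dependence of the solution on
    the forcing term ([solution_stability]), hence uniqueness, and the geometric
    convergence of the Picard iterates, hence existence ([solution_exists]).

    For the semigroup law, splitting the integral at tau shows that
    t |-> x_f (tau + t) solves the equation with forcing term T_tau f. By
    uniqueness it is the solution for T_tau f ([solution_translation]), and
    substituting this in T_sigma (T_tau f) and splitting once more gives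
    T_(sigma + tau) f ([translationD]). Continuity of T_tau follows from the
    stability estimate on [0, tau + N], because a compact subset of the
    half-line lies in some [0, N].

    Paths live on the half-line, and are extended by their value at 0 to
    continuous functions on the whole line. *)

(** * Integrability of the power kernel *)

(** On [1 / (i + 1), N] the integral is at most N^a / a by the fundamental
    theorem of calculus; these intervals increase to ]0, N]. *)
Lemma integrable_powR (R : realType) (a N : R) : 0 < a ->
  lebesgue_measure.-integrable `]0, N] (fun u => (u `^ (a - 1))%:E).
Proof.
move=> a0; have a_neq0 : a != 0 by rewrite gt_eqF.
have mp (D : set R) : measurable_fun D (fun u : R => (u `^ (a - 1))%:E).
  by apply: measurable_funTS; apply/measurable_EFinP; exact: measurable_powR.
apply/integrableP; split; first exact: mp.
under eq_integral do rewrite gee0_abs ?lee_fin ?powR_ge0//.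
pose F (i : nat) : set R := `[i.+1%:R^-1, N]%classic.
have FE : \bigcup_i F i = `]0, N]%classic.
  rewrite /F; apply/seteqP; split => [x [i _]|x] /=; rewrite !in_itv/= => /andP[x0 xN].
    by rewrite xN (lt_le_trans _ x0)// invr_gt0 ltr0n.
  have [i ix] : exists i : nat, x^-1 < i.+1%:R.
    exists (Num.truncn x^-1); exact: truncnS_gt.
  by exists i => //=; rewrite in_itv/= xN andbT ltW// invf_plt ?posrE.
have ndF : nondecreasing_seq F.
  move=> m n mn; rewrite subsetEset => x /=; rewrite /F/= !in_itv/=.
  move=> /andP[mx ->]; rewrite andbT (le_trans _ mx)// lef_pV2 ?posrE//.
  by rewrite ler_nat.
have cvgF : (\int[lebesgue_measure]_(u in F i) (u `^ (a - 1))%:E)%E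
    @[i --> \oo] --> (\int[lebesgue_measure]_(u in \bigcup_i F i) (u `^ (a - 1))%:E)%E.
  apply: ge0_nondecreasing_set_cvg_integral => //.
  - by move=> i; exact: measurable_itv.
  - by move=> i; exact: mp.
  - by move=> i x _; rewrite lee_fin powR_ge0.
apply: (@le_lt_trans _ _ (N `^ a / a)%:E); last by rewrite ltry.
rewrite -FE -(cvg_lim _ cvgF)//.
apply: lime_le; first by apply/cvg_ex; eexists; exact: cvgF.
apply: nearW => i /=; rewrite /F.
set e : R := i.+1%:R^-1; have e0 : 0 < e by rewrite invr_gt0 ltr0n.
have Na0 : 0 <= N `^ a / a by rewrite divr_ge0 ?powR_ge0 ?(ltW a0).
have [Ne|eN] := leP N e.
  rewrite (integral_Sset1 e) ?lee_fin// => x /=; rewrite in_itv/= => /andP[ex xN].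
  by apply/eqP; rewrite eq_le ex (le_trans xN).
have dF (x : R) : 0 < x -> is_derive x 1 (fun u : R => u `^ a / a) (x `^ (a - 1)).
  move=> x0; have := is_derive1_powR a x0 => d.
  have -> : x `^ (a - 1) = a^-1 *: (a * x `^ (a - 1)).
    by rewrite /GRing.scale/= mulrA mulVf// mul1r.
  have -> : (fun u : R => u `^ a / a) = a^-1 \*: (@powR R ^~ a).
    by apply/funext => u; rewrite /= mulrC.
  exact: is_deriveZ.
have cF (x : R) : 0 < x -> {for x, continuous (fun u : R => u `^ a / a)}.
  move=> x0; apply/differentiable_continuous/derivable1_diffP.
  by case: (dF x x0).
have cf (x : R) : 0 < x -> {for x, continuous (fun u : R => u `^ (a - 1))}.
  move=> x0; apply/differentiable_continuous/derivable1_diffP.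
  by case: (is_derive1_powR (a - 1) x0).
rewrite (@continuous_FTC2 _ _ (fun u => u `^ a / a))//.
- by rewrite -EFinB lee_fin lerBlDr lerDl divr_ge0 ?powR_ge0 ?(ltW a0).
- apply: continuous_in_subspaceT => x; rewrite inE/= in_itv/= => /andP[ex _].
  by apply: cf; exact: lt_le_trans ex.
- split.
  + by move=> x; rewrite in_itv/= => /andP[ex _]; case: (dF x (lt_trans e0 ex)).
  + by apply: cvg_at_right_filter; exact: cF.
  + by apply: cvg_at_left_filter; apply: cF; exact: lt_trans eN.
- move=> x; rewrite in_itv/= => /andP[ex _].
  by rewrite derive1E; have [_ ->] := dF x (lt_trans e0 ex).
Qed.

(** * Reflection of the line *)

Lemma measurable_reflection (R : realType) (t : R) :
  measurable_fun setT (fun u : measurableTypeR R => t - u : measurableTypeR R).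
Proof.
by apply: continuous_measurable_fun => x; apply: cvgB => //; exact: cvg_cst.
Qed.

(** A reflection maps the half-open intervals that generate the Borel sets to
    intervals of the same length, and these lengths determine the measure. *)
Lemma lebesgue_measure_reflection (R : realType) (t : R) (A : set R) :
  measurable A ->
  pushforward lebesgue_measure (fun u : R => t - u : measurableTypeR R) A =
  lebesgue_measure A.
Proof.
pose phi : {mfun measurableTypeR R >-> measurableTypeR R} :=
  HB.pack (fun u : R => t - u)
  (isMeasurableFun.Build _ _ _ _ _ (measurable_reflection t)).
move=> mA; apply/esym.
apply: (@lebesgue_measure_unique R (pushforward lebesgue_measure phi)) => //.
move=> X [[a b] _ <-]; rewrite /pushforward/=.
have E (x : R) : (a < t - x <= b) = (t - b <= x < t - a).
  by apply/idP/idP => /andP[? ?]; apply/andP; split; lra.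
rewrite [X in _ = lebesgue_measure X](_ : _ = `[t - b, t - a[%classic); last first.
  by apply/seteqP; split => x /=; rewrite !in_itv/= E.
rewrite !lebesgue_measure_itv/= !lte_fin ltrD2l ltrN2.
by case: ifP => // _; rewrite -!EFinB; congr EFin; ring.
Qed.

Lemma Rintegral_reflection (R : realType) (t : R) (f : R -> R) :
  measurable_fun setT f ->
  lebesgue_measure.-integrable setT (fun u => (f (t - u))%:E) ->
  \int[lebesgue_measure]_s f s = \int[lebesgue_measure]_u f (t - u).
Proof.
move=> mf intf; rewrite /Rintegral; congr fine.
rewrite -(@integral_pushforward _ _ _ _ _ _ (measurable_reflection t)
  lebesgue_measure setT (EFin \o f))//; last exact/measurable_EFinP.
apply: eq_measure_integral; first exact: measurable_reflection.
by move=> mphi A mA _; exact/esym/(lebesgue_measure_reflection t).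
Qed.

(** * Continuous functions of time *)

Lemma continuous_clamp (R : realType) : continuous (fun t : R => Num.max t 0).
Proof. by move=> t; apply: continuous_max => //; exact: cvg_cst. Qed.

Lemma near_eq_continuous (R : realType) (f g : R -> R) (t : R) :
  (\forall s \near t, g s = f s) -> {for t, continuous g} -> {for t, continuous f}.
Proof.
move=> fg; rewrite /prop_for /continuous_at -(nbhs_singleton fg).
by apply: cvg_trans; apply: near_eq_cvg.
Qed.

Lemma near_clamp_le (R : realType) (t0 : R) : \forall t \near t0, Num.max t 0 <= `|t0| + 1.
Proof.
near=> t; rewrite ge_max addr_ge0// andbT.
apply: ltW; near: t; apply: lt_nbhsl.
by rewrite (le_lt_trans (ler_norm t0))// ltrDl.
Unshelve. all: by end_near. Qed.

Lemma continuous_norm_bounded (R : realType) (V : normedModType R) (y : R -> V)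
    (N : R) : continuous y ->
  exists2 M : R, 0 <= M & forall s, 0 <= s <= N -> `|y s| <= M.
Proof.
move=> cy; have [N0|N0] := leP 0 N; last first.
  by exists 0 => // s /andP[s0 sN]; have := le_lt_trans (le_trans s0 sN) N0; rewrite ltxx.
have cn : {within `[0, N], continuous (fun s => `|y s|)}.
  by apply: continuous_subspaceT => s; apply: cvg_norm; exact: cy.
have [c _ cmax] := EVT_max N0 cn.
by exists `|y c| => // s sN; apply: cmax; rewrite in_itv.
Qed.

(** * Volterra integrals with a locally integrable kernel *)

Lemma restrict0E (R : realType) (f : R -> R) (D : set R) u :
  (f \_ D) u = if u \in D then f u else 0.
Proof. by rewrite patchE. Qed.

Definition locally_integrable_kernel (R : realType) (k : R -> R) : Prop :=
  forall N : R, lebesgue_measure.-integrable `]0, N] (EFin \o k).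

Definition volterra (R : realType) (k y : R -> R) (t tau : R) : R :=
  \int[lebesgue_measure]_(s in `[0, tau[) (k (t - s) * y s).

(** The cut-off puts the upper limit of integration into the integrand, so that
    integrals with different limits become convolutions over one interval. *)
Definition window (R : realType) (tau : R) (y : R -> R) : R -> R :=
  y \_ `[0, tau[.

(** The truncated Laplace transform of |k| at lam. It bounds the norm of the
    convolution with k on [0, N] for the weight exp(- lam t). *)
Definition weighted_mass (R : realType) (k : R -> R) (N lam : R) : R :=
  \int[lebesgue_measure]_(u in `]0, N]) (`|k u| * expR (- (lam * u))).

Section scalar_volterra.
Context {R : realType}.
Notation mu := (@lebesgue_measure R).
Variable k : R -> R.
Hypothesis kint : locally_integrable_kernel k.
Implicit Types (y z : R -> R) (t tau N M lam : R).

Lemma windowE tau y s :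
  window tau y s = if 0 <= s < tau then y s else 0.
Proof.
rewrite /window patchE; congr (if _ then _ else _).
by apply/idP/idP; rewrite inE/= in_itv.
Qed.

Lemma measurable_window tau y : continuous y ->
  measurable_fun setT (window tau y).
Proof.
move=> cy; apply/(measurable_restrictT _ _).1 => //.
by apply: measurable_funTS; exact: continuous_measurable_fun.
Qed.

Lemma window_bounded tau y : continuous y ->
  exists2 M : R, 0 <= M & forall s, `|window tau y s| <= M.
Proof.
move=> /(@continuous_norm_bounded _ R^o y tau)[M M0 yM].
exists M => // s; rewrite windowE; case: ifP => [/andP[s0 st]|_]; last by rewrite normr0.
by apply: yM; rewrite s0 ltW.
Qed.

Lemma integrable_convolution z M N t : measurable_fun setT z ->
  (forall s, `|z s| <= M) ->
  mu.-integrable `]0, N] (fun u => (k u * z (t - u))%:E).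
Proof.
move=> mz zM.
apply: (@integrableMl _ _ R mu _ (measurable_itv _) (EFin \o k) (fun u => z (t - u))) => //.
  by apply: measurable_funTS; apply: measurableT_comp => //; exact: measurable_reflection.
exists M; split; first exact: num_real.
by move=> x Mx u _ /=; rewrite (le_trans (zM _))// ltW.
Qed.

(** Any N >= t gives the same convolution, because the window vanishes at t - u
    once u > t. This fixes the domain of integration while t varies. *)
Lemma volterra_convolution y t tau N : continuous y -> 0 <= tau <= t -> t <= N ->
  volterra k y t tau = \int[mu]_(u in `]0, N]) (k u * window tau y (t - u)).
Proof.
move=> cy /andP[tau0 taut] tN; rewrite /volterra Rintegral_mkcond [RHS]Rintegral_mkcond.
pose h s := (k \_ `]0, N]) (t - s) * window tau y s.
have [M M0 yM] := window_bounded tau cy.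
have hE u : h (t - u) = ((fun u => k u * window tau y (t - u)) \_ `]0, N]) u.
  by rewrite /h opprB addrCA subrr addr0 !restrict0E; case: ifP => // _; rewrite mul0r.
transitivity (\int[mu]_s h s).
  congr (Rintegral mu setT _); apply/funext => s.
  rewrite /h windowE !restrict0E.
  have -> : (s \in `[0, tau[%classic) = (0 <= s < tau).
    by apply/idP/idP; rewrite inE/= in_itv.
  case: (boolP (0 <= s < tau)) => [/andP[s0 st]|_]; last by rewrite mulr0.
  rewrite mem_set//= in_itv/= subr_gt0 (lt_le_trans st taut)/=.
  by rewrite lerBlDr (le_trans tN)// lerDl.
rewrite (@Rintegral_reflection _ t); last 2 first.
- apply: measurable_funM; last exact: measurable_window.
  apply: (@measurableT_comp _ _ _ _ _ _ (k \_ `]0, N])); last exact: measurable_reflection.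
  apply/(measurable_restrictT _ _).1 => //.
  by apply/measurable_EFinP; exact: measurable_int (kint N).
- apply: (@eq_integrable _ _ _ mu _ _
    (((fun u => (k u * window tau y (t - u))%:E) \_ `]0, N]))) => //.
    by move=> u _; rewrite hE restrict0E patchE; case: ifP.
  apply/(integrable_mkcond _ _).1 => //.
  by apply: integrable_convolution yM; exact: measurable_window.
by congr (Rintegral mu setT _); apply/funext => u; rewrite hE.
Qed.

(** With the upper limit equal to t, the window may be taken independent of t:
    only times t - u < t are evaluated. This is what makes the t-dependence of
    the integral that of a convolution with a fixed function. *)
Lemma volterra_diag_convolution y t tau N : continuous y -> 0 <= t <= tau -> t <= N ->
  volterra k y t t = \int[mu]_(u in `]0, N]) (k u * window tau y (t - u)).
Proof.
move=> cy /andP[t0 ttau] tN.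
rewrite (@volterra_convolution _ _ _ N)// ?t0 ?lexx//.
apply: eq_Rintegral => u; rewrite inE/= in_itv/= => /andP[u0 _].
by rewrite !windowE ltrBlDr ltrDl u0 (lt_le_trans _ ttau) ?ltrBlDr ?ltrDl.
Qed.

(** Dominated convergence, with bound M |k|. The points a and b are the possible jumps of
    z; as t varies they are met only at u = t - a and u = t - b, a null set. *)
Lemma convolution_continuous z M N (a b : R) : measurable_fun setT z ->
  (forall s, `|z s| <= M) ->
  (forall s, s != a -> s != b -> {for s, continuous z}) ->
  continuous (fun t => \int[mu]_(u in `]0, N]) (k u * z (t - u))).
Proof.
move=> mz zM cz t; apply/(@cvg_nbhsP _ R^o) => w wt.
have fint v := @integrable_convolution z M N v mz zM.
apply: fine_cvg; rewrite fineK; last by apply: integrable_fin_num => //; exact: fint.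
have mf v : measurable_fun `]0, N] (fun u => (k u * z (v - u))%:E).
  exact: measurable_int (fint v).
have [||| _ _] := @dominated_convergence _ _ R mu `]0, N] (measurable_itv _)
  (fun n u => (k u * z (w n - u))%:E) (fun u => (k u * z (t - u))%:E)
  (fun u => (`|k u| * M)%:E) (fun n => mf (w n)) (mf t).
- exists [set t - a; t - b]; split.
  + by apply: measurableU; exact: measurable_set1.
  + apply: null_set_setU; try exact: measurable_set1; exact: lebesgue_measure_set1.
  + move=> u /= nu; apply: contrapT => /not_orP[ua ub]; apply: nu => _.
    apply: cvg_EFin; first exact: nearW.
    apply: cvgM; first exact: cvg_cst.
    apply: continuous_cvg.
      apply: cz; apply/eqP => e; [apply: ua|apply: ub]; rewrite -e; ring.
    by apply: cvgB => //; exact: cvg_cst.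
- apply: (@integrableMl _ _ R mu _ (measurable_itv _) (fun u => `|k u|%:E) (cst M)) => //.
    exact: integrable_norm (kint N).
  exists `|M|; split; first exact: num_real.
  by move=> x Mx u _; exact: ltW.
- by apply: aeW => u n _; rewrite lee_fin normrM ler_wpM2l.
- exact.
Qed.

Lemma integrable_window y t tau N : continuous y ->
  mu.-integrable `]0, N] (fun u => (k u * window tau y (t - u))%:E).
Proof.
move=> cy; have [M _ yM] := window_bounded tau cy.
by apply: integrable_convolution yM => //; exact: measurable_window.
Qed.

Lemma integrable_weighted N lam : 0 <= lam ->
  mu.-integrable `]0, N] (fun u => (`|k u| * expR (- (lam * u)))%:E).
Proof.
move=> lam0.
apply: (@integrableMl _ _ R mu _ (measurable_itv _) (fun u => `|k u|%:E)
  (fun u => expR (- (lam * u)))) => //.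
- exact: integrable_norm (kint N).
- apply: measurable_funTS; apply: measurableT_comp => //.
  by apply: continuous_measurable_fun => u; apply: cvgN; apply: cvgM => //; exact: cvg_cst.
- exists 1; split; first exact: num_real.
  move=> x x1 u /=; rewrite in_itv/= => /andP[u0 _].
  rewrite ger0_norm ?expR_ge0// (le_trans _ (ltW x1))// -expR0 ler_expR.
  by rewrite oppr_le0 mulr_ge0// ltW.
Qed.

Lemma volterraB y1 y2 t tau : continuous y1 -> continuous y2 -> 0 <= tau <= t ->
  volterra k (fun s => y1 s - y2 s) t tau = volterra k y1 t tau - volterra k y2 t tau.
Proof.
move=> c1 c2 taut.
have c12 : continuous (fun s => y1 s - y2 s).
  by move=> s; apply: cvgB; [exact: c1|exact: c2].
rewrite !(@volterra_convolution _ _ _ t)//.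
rewrite -RintegralB//; try exact: integrable_window.
apply: eq_Rintegral => u _; rewrite !windowE -mulrBr; case: ifP => // _.
by rewrite subr0.
Qed.

(** The window of [0, tau + sigma[ is that of [0, tau[ plus the window of
    [0, sigma[ translated by tau, so no second change of variables is needed. *)
Lemma volterra_shift y t tau sigma : continuous y -> 0 <= tau -> 0 <= sigma <= t ->
  volterra k y (tau + t) (tau + sigma) =
  volterra k y (tau + t) tau + volterra k (fun s => y (tau + s)) t sigma.
Proof.
move=> cy tau0 /andP[sigma0 sigmat]; have t0 := le_trans sigma0 sigmat.
have cys : continuous (fun s => y (tau + s)).
  move=> s; apply: continuous_comp; last exact: cy.
  by apply: cvgD => //; exact: cvg_cst.
have h1 : 0 <= tau <= tau + t by rewrite tau0 lerDl.
have h2 : 0 <= tau + sigma <= tau + t by rewrite addr_ge0//= lerD2l.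
have h3 : 0 <= sigma <= t by rewrite sigma0.
have h4 : t <= tau + t by rewrite lerDr.
rewrite !(@volterra_convolution _ _ _ (tau + t))//.
rewrite -RintegralD//; try exact: integrable_window.
apply: eq_Rintegral => u _; rewrite !windowE -mulrDr; congr (_ * _).
rewrite -[tau + t - u]addrA; set v := t - u.
case: ifP => [/andP[v0 vs]|/negbT v0]; case: ifP => [/andP[v1 vs1]|/negbT v1];
  case: ifP => [/andP[v2 vs2]|/negbT v2]; rewrite ?addr0 ?add0r//;
  exfalso; lra.
Qed.

(** The exponential weight turns the convolution bound into multiplication by
    the truncated Laplace transform: exp(lam (t - u)) = exp(lam t) exp(- lam u). *)
Lemma volterra_bound y t tau N M lam : continuous y -> 0 <= tau <= t -> t <= N ->
  0 <= M -> 0 <= lam -> (forall s, 0 <= s < tau -> `|y s| <= M * expR (lam * s)) ->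
  `|volterra k y t tau| <= M * expR (lam * t) * weighted_mass k N lam.
Proof.
move=> cy taut tN M0 lam0 yM; rewrite (@volterra_convolution _ _ _ N)//.
have iw := integrable_window t tau N cy.
apply: (le_trans (le_normr_Rintegral _ iw)) => //.
have ik := integrable_weighted N lam0.
rewrite /weighted_mass -RintegralZl//.
apply: le_Rintegral => //.
- exact: integrable_norm iw.
- apply: (eq_integrable _ _ _ _ (integrableZl _ (M * expR (lam * t)) ik)) => //.
- move=> u _; rewrite normrM [leRHS]mulrCA ler_wpM2l// -mulrA -expRD.
  rewrite windowE; case: ifP => [sin|_].
    by rewrite (le_trans (yM _ sin))// ler_wpM2l// ler_expR mulrBr.
  by rewrite normr0 mulr_ge0// expR_ge0.
Qed.

(** Dominated convergence along integer values of lam, with bound |k|. *)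
Lemma weighted_mass_small N e : 0 < e ->
  exists2 lam : R, 0 <= lam & weighted_mass k N lam <= e.
Proof.
move=> e0.
suff /cvgrPdist_le /(_ _ e0)[n _ /(_ _ (leqnn n))] :
    weighted_mass k N n%:R @[n --> \oo] --> 0.
  by rewrite sub0r normrN => /(le_trans (ler_norm _)) ?; exists n%:R.
have ik (n : nat) := integrable_weighted N (ler0n R n).
have mz : mu.-integrable `]0, N] (fun=> 0%:E).
  exact: integrable0.
have [||| _ _] := @dominated_convergence _ _ R mu `]0, N] (measurable_itv _)
  (fun n u => (`|k u| * expR (- (n%:R * u)))%:E) (fun=> 0%:E)
  (fun u => `|k u|%:E) (fun n => measurable_int _ (ik n)) (measurable_int _ mz).
- apply: aeW => u /=; rewrite in_itv/= => /andP[u0 _].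
  apply: cvg_EFin; first exact: nearW.
  rewrite -[X in _ --> X](mulr0 `|k u|); apply: cvgM; first exact: cvg_cst.
  under eq_fun do rewrite -mulrN expRM_natl.
  by apply: cvg_expr; rewrite ger0_norm ?expR_ge0// -expR0 ltr_expR oppr_lt0.
- exact: integrable_norm (kint N).
- apply: aeW => u n; rewrite /= in_itv/= => /andP[u0 _].
  rewrite lee_fin normrM normr_id ler_piMr// ger0_norm ?expR_ge0//.
  by rewrite -expR0 ler_expR oppr_le0 mulr_ge0// ltW.
rewrite integral0 => h; exact: fine_cvg.
Qed.

Lemma window_continuous y tau s : continuous y -> s != 0 -> s != tau ->
  {for s, continuous (window tau y)}.
Proof.
move=> cy s0 st.
have [sin|sout] := boolP (0 <= s < tau).
  have /andP[s1 s2] : 0 < s < tau by case/andP: sin => s1 ->; rewrite lt_neqAle eq_sym s0 s1.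
  apply: (near_eq_continuous (g := y)); last exact: cy.
  near=> v; rewrite windowE; case: ifPn => // /negP[]; apply/andP; split.
    by apply: ltW; near: v; exact: lt_nbhsr.
  by near: v; exact: lt_nbhsl.
apply: (near_eq_continuous (g := cst 0)); last exact: cvg_cst.
have [s1|s1] := ltP s 0.
  near=> v; rewrite windowE; case: ifPn => // /andP[]; rewrite leNgt => /negP[].
  by near: v; exact: lt_nbhsl.
have s2 : tau < s by move: sout; rewrite s1/= -leNgt lt_neqAle eq_sym st.
near=> v; rewrite windowE; case: ifPn => // /andP[_]; rewrite ltNge => /negP[].
by apply: ltW; near: v; exact: lt_nbhsr.
Unshelve. all: by end_near. Qed.

Lemma continuous_convolution_window y tau N : continuous y ->
  continuous (fun t => \int[mu]_(u in `]0, N]) (k u * window tau y (t - u))).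
Proof.
move=> cy; have [M _ yM] := window_bounded tau cy.
apply: (convolution_continuous (measurable_window tau cy) yM).
by move=> s; exact: window_continuous.
Qed.

(** The statement is local in t, so the interval ]0, N] of the convolution may be
    chosen from a bound on nearby times. *)
Lemma continuous_volterra_lag y tau : continuous y -> 0 <= tau ->
  continuous (fun t => volterra k y (tau + Num.max t 0) tau).
Proof.
move=> cy tau0 t0; pose N := tau + (`|t0| + 1).
pose G t := \int[mu]_(u in `]0, N]) (k u * window tau y (t - u)).
apply: (near_eq_continuous (g := G \o (fun t => tau + Num.max t 0))).
  near=> t; rewrite /G /= -volterra_convolution//.
    by rewrite tau0 lerDl le_max lexx orbT.
  by rewrite lerD2l; near: t; exact: near_clamp_le.
apply: continuous_comp; last exact: continuous_convolution_window.
by apply: cvgD; [exact: cvg_cst|exact: continuous_clamp].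
Unshelve. all: by end_near. Qed.

Lemma continuous_volterra_diag y : continuous y ->
  continuous (fun t => volterra k y (Num.max t 0) (Num.max t 0)).
Proof.
move=> cy t0; pose N := `|t0| + 1.
pose G t := \int[mu]_(u in `]0, N]) (k u * window N y (t - u)).
apply: (near_eq_continuous (g := G \o (fun t => Num.max t 0))).
  near=> t; have tN : Num.max t 0 <= N by near: t; exact: near_clamp_le.
  by rewrite /G /= -volterra_diag_convolution// le_max lexx orbT tN.
apply: continuous_comp; last exact: continuous_convolution_window.
exact: continuous_clamp.
Unshelve. all: by end_near. Qed.

End scalar_volterra.

(** * Row vectors and geometric convergence *)

Section row_vectors.
Context {R : realType} {d : nat}.
Implicit Types v : 'rV[R]_d.

Lemma rV_norm_le v (M : R) : 0 <= M -> (forall i, `|v 0 i| <= M) -> `|v| <= M.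
Proof.
move=> M0 vM; rewrite [leLHS]/Num.Def.normr/= mx_normrE (bigmax_le _ M0)//=.
by move=> [i j] _ /=; rewrite ord1.
Qed.

Lemma rV_coord_le v i : `|v 0 i| <= `|v|.
Proof.
by rewrite [leRHS]/Num.Def.normr/= mx_normrE; apply/bigmax_geP; right => /=; exists (0, i).
Qed.

Lemma continuous_rV (y : R -> 'rV[R]_d) :
  (forall i, continuous (fun t => y t 0 i)) -> continuous y.
Proof.
move=> cy t; apply/cvgrPdist_le => e e0.
have yi i : \forall s \near t, `|y t 0 i - y s 0 i| <= e.
  by have /cvgrPdist_le := cy i t; exact.
near=> s; apply: rV_norm_le; first exact: ltW.
move=> i; rewrite !mxE; move: i; near: s.
exact: (@filter_forall _ _ _ (nbhs t) _ yi).
Unshelve. all: by end_near. Qed.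

Lemma continuous_coord (y : R -> 'rV[R]_d) i : continuous y ->
  continuous (fun t => y t 0 i).
Proof.
move=> cy t; apply: (@continuous_comp _ _ _ y (fun v : 'rV[R]_d => v 0 i)).
  exact: cy.
exact: coord_continuous.
Qed.

End row_vectors.

Lemma geometric_squeeze (R : realType) (a C : R) :
  (forall n, a <= C * 2^-1 ^+ n) -> a <= 0.
Proof.
move=> aC; rewrite leNgt; apply/negP => a0.
have : C * 2^-1 ^+ n @[n --> \oo] --> C * 0.
  apply: cvgM; first exact: cvg_cst.
  by apply: cvg_expr; rewrite ger0_norm ?invf_lt1 ?ltr1n.
rewrite mulr0 => /cvgrPdist_lt/(_ _ a0)[n _ /(_ _ (leqnn n))].
rewrite sub0r normrN => /(le_lt_trans (ler_norm _)).
by rewrite ltNge aC.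
Qed.

Lemma geometric_limit_continuous (R : realType) (V : normedModType R)
    (Y : nat -> R -> V) (x : R -> V) :
  (forall n, continuous (Y n)) ->
  (forall N, exists C, forall n t, t <= N -> `|Y n t - x t| <= C * 2^-1 ^+ n) ->
  continuous x.
Proof.
move=> cY Yx t; have [C xC] := Yx (t + 1).
apply/cvgrPdist_lt => e e0.
have [n Cn] : exists n, C * 2^-1 ^+ n < e / 3.
  apply: contrapT => /forallNP h; have : e / 3 <= 0.
    by apply: (@geometric_squeeze _ _ C) => n; rewrite leNgt; apply/negP.
  by rewrite leNgt divr_gt0.
have /cvgrPdist_lt/(_ (e / 3)) := cY n t; rewrite divr_gt0// => /(_ isT) Yt.
near=> s.
have st : s <= t + 1 by apply: ltW; near: s; apply: lt_nbhsl; rewrite ltrDl.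
have h1 : `|x t - Y n t| < e / 3.
  by rewrite distrC (le_lt_trans (xC n t _))// lerDl.
have h2 : `|Y n s - x s| < e / 3 by rewrite (le_lt_trans (xC n s _)).
have h3 : `|Y n t - Y n s| < e / 3 by near: s.
have -> : x t - x s = (x t - Y n t) + (Y n t - Y n s) + (Y n s - x s).
  by rewrite !addrA !subrK.
rewrite (le_lt_trans (ler_normD _ _))// (le_lt_trans (lerD (ler_normD _ _) (lexx _)))//.
lra.
Unshelve. all: by end_near. Qed.

Lemma continuous_lipschitz (R : realType) (V W : normedModType R) (g : V -> W)
    (K : R) : 0 <= K -> (forall u v, `|g u - g v| <= K * `|u - v|) -> continuous g.
Proof.
move=> K0 gK u; apply/cvgrPdist_le => e e0.
near=> v; rewrite (le_trans (gK _ _))//.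
rewrite (@le_trans _ _ ((K + 1) * `|u - v|))// ?ler_wpM2r ?lerDl//.
rewrite -ler_pdivlMl ?ltr_pwDr// mulrC.
near: v; have /cvgrPdist_le : v @[v --> u] --> u by exact: cvg_id.
by apply; rewrite divr_gt0// ltr_pwDr.
Unshelve. all: by end_near. Qed.

Lemma geometric_lim_dist (R : realType) (u : nat -> R) (C : R) :
  (forall n, `|u n.+1 - u n| <= C * 2^-1 ^+ n) ->
  forall n, `|u n - lim (u @ \oo)| <= 2 * C * 2^-1 ^+ n.
Proof.
move=> uC.
have C0 : 0 <= C by have := uC 0; rewrite expr0 mulr1; apply: le_trans.
have up n p : `|u (n + p)%N - u n| <= 2 * C * (2^-1 ^+ n - 2^-1 ^+ (n + p)).
  elim: p => [|p ih]; first by rewrite addn0 !subrr normr0 mulr0.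
  rewrite addnS -(subrK (u (n + p)%N) (u _)) -addrA.
  rewrite (le_trans (ler_normD _ _))// (le_trans (lerD (uC _) ih))//.
  by rewrite exprS; lra.
have un n m : (n <= m)%N -> `|u n - u m| <= 2 * C * 2^-1 ^+ n.
  move=> /subnKC <-; rewrite distrC (le_trans (up _ _))//.
  by rewrite ler_wpM2l ?mulr_ge0// lerBlDr lerDl exprn_ge0.
have ul : cvgn u.
  apply/cauchy_cvgP/cauchy_exP => e e0.
  have [n Cn] : exists n, 2 * C * 2^-1 ^+ n < e.
    apply: contrapT => /forallNP h; have : e <= 0.
      by apply: (@geometric_squeeze _ _ (2 * C)) => n; rewrite leNgt; apply/negP.
    by rewrite leNgt e0.
  exists (u n); exists n => // m nm /=.
  by rewrite -ball_normE/=; exact: le_lt_trans (un _ _ nm) Cn.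
move=> n; have ul' : `|u n - u m| @[m --> \oo] --> `|u n - lim (u @ \oo)|.
  by apply: cvg_norm; apply: cvgB => //; exact: cvg_cst.
rewrite -(cvg_lim _ ul')//; apply: limr_le; first by apply/cvg_ex; eexists; exact: ul'.
by exists n => // m; exact: un.
Qed.

(** * Volterra equations with a Lipschitz nonlinearity *)

Definition volterra_rV (R : realType) (d : nat) (k : R -> R) (y : R -> 'rV[R]_d)
    (t tau : R) : 'rV[R]_d :=
  \row_i volterra k (fun s => y s 0 i) t tau.

Definition solves (R : realType) (d : nat) (k : R -> R)
    (g : 'rV[R]_d -> 'rV[R]_d) (f x : R -> 'rV[R]_d) : Prop :=
  forall t, 0 <= t -> x t = f t + volterra_rV k (g \o x) t t.

Section volterra_equation.
Context {R : realType} {d : nat}.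
Variable k : R -> R.
Hypothesis kint : locally_integrable_kernel k.
Variables (g : 'rV[R]_d -> 'rV[R]_d) (K : R).
Hypotheses (K0 : 0 <= K) (gK : forall u v, `|g u - g v| <= K * `|u - v|).
Implicit Types (f x y : R -> 'rV[R]_d) (s t tau N M : R).

Lemma continuous_compg x : continuous x -> continuous (g \o x).
Proof.
by move=> cx t; apply: continuous_comp; [exact: cx|exact: (continuous_lipschitz K0 gK)].
Qed.

Lemma continuous_volterra_rV_diag y : continuous y ->
  continuous (fun t => volterra_rV k y (Num.max t 0) (Num.max t 0)).
Proof.
move=> cy; apply: continuous_rV => i; under eq_fun do rewrite mxE.
by apply: continuous_volterra_diag => //; exact: continuous_coord.
Qed.

Lemma continuous_volterra_rV_lag y tau : continuous y -> 0 <= tau ->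
  continuous (fun t => volterra_rV k y (tau + Num.max t 0) tau).
Proof.
move=> cy tau0; apply: continuous_rV => i; under eq_fun do rewrite mxE.
by apply: continuous_volterra_lag => //; exact: continuous_coord.
Qed.

Lemma volterra_rV_shift y t tau sigma : continuous y -> 0 <= tau -> 0 <= sigma <= t ->
  volterra_rV k y (tau + t) (tau + sigma) =
  volterra_rV k y (tau + t) tau + volterra_rV k (fun s => y (tau + s)) t sigma.
Proof.
move=> cy tau0 sigmat; apply/rowP => i; rewrite !mxE.
by rewrite volterra_shift//; exact: continuous_coord.
Qed.

(** The key estimate. Choosing lam with (K + 1) * weighted_mass <= 1/2 makes the
    operator a strict contraction on [0, N] for the weighted supremum distance,
    however large N is. The case tau < t is kept because it controls the memory
    term of the translation operators as well. *)
Lemma volterra_contraction N : exists2 lam : R, 0 <= lam &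
  forall x1 x2 M t tau, continuous x1 -> continuous x2 ->
    0 <= tau <= t -> t <= N -> 0 <= M ->
    (forall s, 0 <= s < tau -> `|x1 s - x2 s| <= M * expR (lam * s)) ->
  `|volterra_rV k (g \o x1) t tau - volterra_rV k (g \o x2) t tau| <=
    M / 2 * expR (lam * t).
Proof.
have K1 : 0 < K + 1 by rewrite ltr_pwDr.
have [|lam lam0 wlam] := @weighted_mass_small _ _ kint N (2^-1 / (K + 1)).
  by rewrite divr_gt0.
exists lam => // x1 x2 M t tau c1 c2 taut tN M0 xM.
have Me0 : 0 <= M / 2 * expR (lam * t) by rewrite mulr_ge0 ?expR_ge0 ?divr_ge0.
apply: rV_norm_le => // i; rewrite !mxE.
have cg1 := continuous_coord (i := i) (continuous_compg c1).
have cg2 := continuous_coord (i := i) (continuous_compg c2).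
rewrite -volterraB//.
apply: le_trans (@volterra_bound _ _ kint _ _ _ N ((K + 1) * M) lam _ taut tN _ lam0 _) _.
- by move=> s; apply: cvgB; [exact: cg1|exact: cg2].
- by rewrite mulr_ge0// ltW.
- move=> s stau; have := rV_coord_le (g (x1 s) - g (x2 s)) i; rewrite !mxE => /le_trans; apply.
  rewrite (le_trans (gK _ _))// -mulrA ler_pM// ?lerDl//.
  exact: xM.
- apply: le_trans (ler_wpM2l _ wlam) _.
    by rewrite !mulr_ge0 ?expR_ge0// ltW.
  rewrite le_eqVlt; apply/orP; left; apply/eqP; field; exact: lt0r_neq0.
Qed.

(** Let m be the weighted supremum distance of x1 and x2 on [0, N]. At a point
    where it is attained the two equations give m <= delta + m / 2, that is
    m <= 2 delta; undoing the weight costs the factor exp(lam N). *)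
Lemma solution_stability N : exists2 C, 0 <= C &
  forall f1 f2 x1 x2 delta, continuous x1 -> continuous x2 ->
    solves k g f1 x1 -> solves k g f2 x2 -> 0 <= delta ->
    (forall t, 0 <= t <= N -> `|f1 t - f2 t| <= delta) ->
  (forall t, 0 <= t <= N -> `|x1 t - x2 t| <= C * delta) /\
  (forall t tau, 0 <= tau <= t -> t <= N ->
   `|volterra_rV k (g \o x1) t tau - volterra_rV k (g \o x2) t tau| <= C * delta).
Proof.
have [lam lam0 contr] := volterra_contraction N.
exists (2 * expR (lam * N)); first by rewrite mulr_ge0// expR_ge0.
move=> f1 f2 x1 x2 delta c1 c2 s1 s2 delta0 fd.
have [N0|N0] := ltP N 0.
  by split=> [t /andP[t0 tN]|t tau /andP[tau0 taut] tN]; exfalso; lra.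
(* h is the weighted distance; c below is a point where it is maximal. *)
pose h s := `|x1 s - x2 s| * expR (- (lam * s)).
have ch : continuous h.
  move=> s; apply: cvgM.
    by apply: cvg_norm; apply: cvgB; [exact: c1|exact: c2].
  apply: continuous_comp; last exact: continuous_expR.
  by apply: cvgN; apply: cvgM => //; exact: cvg_cst.
have [c cN hc] := EVT_max N0 (continuous_subspaceT ch).
have {}hc s : 0 <= s <= N -> `|x1 s - x2 s| <= h c * expR (lam * s).
  move=> sN; have /hc : s \in `[0, N] by rewrite in_itv.
  by rewrite {1}/h expRN ler_pdivrMr ?expR_gt0.
have hc0 : 0 <= h c by rewrite mulr_ge0 ?expR_ge0.
have V t tau : 0 <= tau <= t -> t <= N ->
   `|volterra_rV k (g \o x1) t tau - volterra_rV k (g \o x2) t tau| <= h c / 2 * expR (lam * t).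
  move=> taut tN; apply: contr => // s /andP[s0 st]; apply: hc.
  by rewrite s0; case/andP: taut => _ taut; rewrite (le_trans _ tN)// (le_trans _ taut)// ltW.
have hcd : h c <= 2 * delta.
  move: cN; rewrite in_itv/= => /andP[c0 cN].
  have : h c <= delta + h c / 2.
    rewrite {1}/h expRN ler_pdivrMr ?expR_gt0// s1// s2// opprD addrACA.
    rewrite (le_trans (ler_normD _ _))// mulrDl lerD//.
      rewrite (le_trans (fd _ _)) ?c0// ler_peMr// -expR0 ler_expR mulr_ge0//.
    by apply: V => //; rewrite c0 lexx.
  lra.
have eN t : t <= N -> expR (lam * t) <= expR (lam * N).
  by move=> tN; rewrite ler_expR ler_wpM2l.
split=> [t /andP[t0 tN]|t tau taut tN].
  rewrite (le_trans (hc _ _)) ?t0// [leRHS]mulrAC ler_pM ?expR_ge0//; exact: eN.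
rewrite (le_trans (V _ _ _ _))// [leRHS]mulrAC ler_pM ?expR_ge0 ?divr_ge0//; last exact: eN.
lra.
Qed.

Lemma solution_unique f x1 x2 : continuous x1 -> continuous x2 ->
  solves k g f x1 -> solves k g f x2 -> forall t, 0 <= t -> x1 t = x2 t.
Proof.
move=> c1 c2 s1 s2 t t0; have [C C0 stab] := solution_stability t.
have [|+ _] := stab f f x1 x2 0 c1 c2 s1 s2 (lexx _).
  by move=> s _; rewrite subrr normr0.
move=> /(_ t); rewrite t0 lexx mulr0 normr_le0 subr_eq0 => /(_ isT)/eqP.
exact.
Qed.

End volterra_equation.

(** * Existence by Picard iteration *)

Section existence.
Context {R : realType} {d : nat}.
Variable k : R -> R.
Hypothesis kint : locally_integrable_kernel k.
Variables (g : 'rV[R]_d -> 'rV[R]_d) (K : R).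
Hypotheses (K0 : 0 <= K) (gK : forall u v, `|g u - g v| <= K * `|u - v|).
Implicit Types (f x y : R -> 'rV[R]_d) (s t tau N M : R).

(** Times are clamped to [0, +oo[ so that every iterate is continuous on the whole
    line. *)
Fixpoint picard f (n : nat) (t : R) : 'rV[R]_d :=
  if n is n'.+1 then
    f (Num.max t 0) + volterra_rV k (g \o picard f n') (Num.max t 0) (Num.max t 0)
  else f (Num.max t 0).

Lemma continuous_picard f n : continuous f -> continuous (picard f n).
Proof.
move=> cf; have cfm : continuous (fun t => f (Num.max t 0)).
  by move=> t; apply: continuous_comp; [exact: continuous_clamp|exact: cf].
elim: n => [|n ih] //= t; apply: cvgD; first exact: cfm.
by apply: continuous_volterra_rV_diag => //; exact: (continuous_compg K0 gK).
Qed.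

(** Each step halves the weighted distance of consecutive iterates on [0, N], and
    M bounds the first one; C is M times the largest weight. *)
Lemma picard_geometric f N : continuous f -> exists C, forall n t, t <= N ->
  `|picard f n.+1 t - picard f n t| <= C * 2^-1 ^+ n.
Proof.
move=> cf; pose N' := Num.max N 0.
have [lam lam0 contr] := volterra_contraction kint K0 gK N'.
have cp n := continuous_picard (n := n) cf.
have [|M M0 pM] := @continuous_norm_bounded _ _ (fun t => picard f 1 t - picard f 0 t) N'.
  by move=> t; apply: cvgB; exact: cp.
have key n t : 0 <= t <= N' ->
    `|picard f n.+1 t - picard f n t| <= M * 2^-1 ^+ n * expR (lam * t).
  elim: n t => [|n ih] t /[dup] tN /andP[t0 tN'].
    rewrite expr0 mulr1 (le_trans (pM _ tN))// ler_peMr//.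
    by rewrite -expR0 ler_expR mulr_ge0.
  rewrite [picard f n.+2 t]/= [X in _ - X]/= (max_idPl t0) opprD addrACA subrr add0r.
  apply: le_trans (contr _ _ (M * 2^-1 ^+ n) _ _ _ _ _ _ _ _) _ => //.
  - exact: (cp n.+1).
  - by rewrite t0 lexx.
  - by rewrite mulr_ge0 ?exprn_ge0.
  - by move=> s /andP[s0 st]; apply: (ih s); rewrite s0 (le_trans _ tN')// ltW.
  - by rewrite ler_wpM2r ?expR_ge0// exprS mulrCA mulrC.
have pmax n t : picard f n t = picard f n (Num.max t 0).
  by case: n => [|n] /=; rewrite -maxA maxxx.
exists (M * expR (lam * N')) => n t tN; rewrite pmax [X in _ - X]pmax.
have tN' : Num.max t 0 <= N' by rewrite ge_max !le_max tN lexx orbT.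
rewrite (le_trans (key _ _ _)) ?tN' ?le_max ?lexx ?orbT// mulrAC ler_wpM2r ?exprn_ge0//.
by rewrite ler_wpM2l// ler_expR ler_wpM2l.
Qed.

(** The limit x is locally uniform, so it is continuous. It satisfies the
    equation since |x - f - V x| <= |x - X_(n+1)| + |V X_n - V x|, where V is the
    integral operator and X_n the n-th iterate, and both terms are O(2^-n). *)
Lemma solution_exists f : continuous f ->
  exists2 x : R -> 'rV[R]_d, continuous x & solves k g f x.
Proof.
move=> cf; have cp n := continuous_picard (n := n) cf.
pose x t : 'rV[R]_d := \row_i lim (picard f n t 0 i @[n --> \oo]).
have xP N : exists2 C, 0 <= C &
    forall n t, t <= N -> `|picard f n t - x t| <= C * 2^-1 ^+ n.
  have [C pC] := picard_geometric N cf.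
  have C0 : 0 <= 2 * C.
    have := pC 0 N (lexx N); rewrite expr0 mulr1 => C0.
    by rewrite mulr_ge0// (le_trans _ C0).
  exists (2 * C) => // n t tN.
  apply: rV_norm_le => [|i]; first by rewrite mulr_ge0 ?exprn_ge0.
  rewrite !mxE; apply: (geometric_lim_dist (u := fun n => picard f n t 0 i)) => m.
  have := rV_coord_le (picard f m.+1 t - picard f m t) i.
  by rewrite !mxE => /le_trans; apply; exact: pC.
have cx : continuous x.
  apply: geometric_limit_continuous cp _ => N.
  by have [C _ pC] := xP N; exists C.
exists x => // t t0; apply/eqP; rewrite -subr_eq0 -normr_le0.
have [lam lam0 contr] := volterra_contraction kint K0 gK t.
have [C C0 xC] := xP t.
apply: (@geometric_squeeze _ _ (C + C / 2 * expR (lam * t))) => n.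
have Cn0 : 0 <= C * 2^-1 ^+ n by rewrite mulr_ge0 ?exprn_ge0.
have pE : picard f n.+1 t = f t + volterra_rV k (g \o picard f n) t t.
  by rewrite /= (max_idPl t0).
have -> : x t - (f t + volterra_rV k (g \o x) t t) = (x t - picard f n.+1 t) +
    (volterra_rV k (g \o picard f n) t t - volterra_rV k (g \o x) t t).
  by rewrite pE !opprD !addrA subrK.
rewrite (le_trans (ler_normD _ _))// mulrDl lerD//.
  rewrite distrC (le_trans (xC _ _ _))// ler_wpM2l// exprS ler_piMl ?exprn_ge0//.
  by rewrite invf_le1 ?ler1n.
apply: le_trans (contr _ _ (C * 2^-1 ^+ n) _ _ (cp n) cx _ _ _ _) _ => //.
- by rewrite t0 lexx.
- move=> s /andP[s0 st]; apply: le_trans (xC _ _ (ltW st)) _.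
  by rewrite ler_peMr// -expR0 ler_expR mulr_ge0.
- by rewrite le_eqVlt; apply/orP; left; apply/eqP; ring.
Qed.

End existence.

(** * Paths on the half-line and their topology *)

Section paths.
Context {R : realType} {d : nat}.
Implicit Types (f h x : cts_paths R d) (s t N e delta : R).

Lemma clamp_in_Rplus t : Num.max t 0 \in Rplus R.
Proof. by rewrite inE /Rplus/= le_max lexx orbT. Qed.

Definition clamp t : Rplus R := exist _ (Num.max t 0) (clamp_in_Rplus t).

Lemma continuous_clamp_Rplus : continuous clamp.
Proof. by apply: continuous_comp_initial; exact: continuous_clamp. Qed.

Lemma clampK (u : Rplus R) : clamp (set_val u) = u.
Proof.
apply: val_inj => /=; apply/max_idPl; exact: (set_valP u).
Qed.

(** Paths as functions on the whole line, constant on the negative times, to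
    which the results on Volterra equations apply. *)
Definition path_ext f t : 'rV[R]_d := path_at f (Num.max t 0).

Lemma path_at_val f (u : Rplus R) : path_at f (set_val u) = f u.
Proof. by have /(congr1 (fun g => g u)) := valLK point (f : Rplus R -> 'rV[R]_d). Qed.

Lemma path_extE f t : path_ext f t = f (clamp t).
Proof. by rewrite -path_at_val. Qed.

Lemma path_ext_ge0 f t : 0 <= t -> path_ext f t = path_at f t.
Proof. by move=> t0; rewrite /path_ext (max_idPl t0). Qed.

Lemma continuous_path_ext f : continuous (path_ext f).
Proof.
rewrite (_ : path_ext f = f \o clamp); last by apply/funext => t; exact: path_extE.
move=> t; apply: continuous_comp; first exact: continuous_clamp_Rplus.
exact: cts_fun.
Qed.

Lemma path_eq f h : (forall t, 0 <= t -> path_at f t = path_at h t) -> f = h.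
Proof.
move=> fh; apply/continuousEP => u; rewrite -!path_at_val; apply: fh.
exact: (set_valP u).
Qed.

Lemma continuous_restriction (F : R -> 'rV[R]_d) : continuous F ->
  continuous (F \o (set_val : Rplus R -> R)).
Proof.
move=> cF u; apply: continuous_comp; last exact: cF.
exact: initial_continuous.
Qed.

Definition path_of (F : R -> 'rV[R]_d) (cF : continuous F) : cts_paths R d :=
  mkcts (continuous_restriction cF).

Lemma path_ofE (F : R -> 'rV[R]_d) (cF : continuous F) t : 0 <= t ->
  path_at (path_of cF) t = F t.
Proof. by move=> t0; rewrite -path_ext_ge0// path_extE -[in RHS](max_idPl t0). Qed.

Lemma compact_clamp_image N : compact (clamp @` `[0, N]).
Proof.
apply: continuous_compact; last exact: segment_compact.
by apply: continuous_subspaceT; exact: continuous_clamp_Rplus.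
Qed.

Lemma compact_Rplus_bounded (A : set (Rplus R)) : compact A ->
  exists N : R, forall u, A u -> set_val u <= N.
Proof.
move=> cA; have : compact (set_val @` A).
  apply: continuous_compact => //; apply: continuous_subspaceT.
  exact: initial_continuous.
move=> /compact_bounded[M [_ AM]]; exists (M + 1) => u Au.
rewrite (le_trans (ler_norm _))//; apply: AM; first by rewrite ltrDl.
by exists u.
Qed.

(** A basic neighbourhood: [0, N] is compact, as the image of a segment of the
    line under the retraction onto the half-line. *)
Lemma near_path f N delta : 0 < delta ->
  \forall h \near f, forall t, 0 <= t <= N -> `|path_ext f t - path_ext h t| <= delta.
Proof.
move=> delta0.
have /(_ _ (@compact_clamp_image N)) := fun A => @fam_nbhs _ _ compact A _
  (f : Rplus R -> 'rV[R]_d) (entourage_ball _ (PosNum delta0)).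
move=> nf; have := @initial_continuous _ _
  (fun f : continuousType (Rplus R) 'rV[R]_d =>
       (f : Rplus R -> 'rV[R]_d) : {family compact, Rplus R -> 'rV[R]_d}) f _ nf.
move=> nf2; apply: (@filterS _ _ (@nbhs_filter (cts_paths R d) f) _ _ _ nf2).
move=> h /= fh t tN; rewrite !path_extE.
have := fh (clamp t); rewrite -ball_normE /= => fh'; apply: ltW; apply: fh'.
by exists t => //=; rewrite in_itv.
Qed.

(** Conversely, uniform closeness on the intervals [0, N] suffices: a compact set
    of times is bounded. *)
Lemma continuous_paths (Phi : cts_paths R d -> cts_paths R d) :
  (forall f N e, 0 < e -> \forall h \near f, forall t, 0 <= t <= N ->
    `|path_ext (Phi f) t - path_ext (Phi h) t| <= e) ->
  continuous Phi.
Proof.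
move=> PhiP; apply: continuous_comp_initial => f.
have nf : Filter (nbhs f) := @nbhs_filter (cts_paths R d) f.
apply/(fam_cvgP _ _ (fmap_filter _ nf)) => A cA P /uniform_nbhs[E [entE EP]].
have [N AN] := compact_Rplus_bounded cA.
move: entE; rewrite -entourage_ballE => -[e /= e0 eE].
have := PhiP f N (e / 2); rewrite divr_gt0// => /(_ isT).
apply: filterS => h Phih; apply: EP => u Au; apply: eE => /=.
rewrite -ball_normE /=.
have := Phih (set_val u); rewrite !path_extE clampK AN// andbT.
move=> /(_ (set_valP u)) /le_lt_trans; apply; lra.
Qed.

End paths.

(** * The translation semigroup *)

Definition abel_kernel (R : realType) (alpha u : R) : R :=
  (Gamma alpha)^-1 * u `^ (alpha - 1).

Lemma abel_kernel_locally_integrable (R : realType) (alpha : R) :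
  0 < alpha -> locally_integrable_kernel (abel_kernel alpha).
Proof.
move=> alpha0 N.
exact: (integrableZl _ (Gamma alpha)^-1 (integrable_powR N alpha0)).
Qed.

Section semiflow.
Context {R : realType} {d : nat}.
Variables (alpha : R) (g : 'rV[R]_d -> 'rV[R]_d) (K : R).
Hypotheses (alpha0 : 0 < alpha) (K0 : 0 <= K)
  (gK : forall u v, `|g u - g v| <= K * `|u - v|).
Implicit Types (f h x : cts_paths R d) (s t theta tau sigma : R).

Let kint := abel_kernel_locally_integrable alpha0.
Local Notation k := (abel_kernel alpha).
Local Notation sol f := (path_ext (solution alpha g f)).

Lemma memoryE x t tau :
  memory alpha g x t tau = volterra_rV k (g \o path_ext x) t tau.
Proof.
apply/rowP => i; rewrite !mxE; apply: eq_Rintegral => s.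
rewrite inE/= in_itv/= => /andP[s0 _].
by rewrite path_ext_ge0.
Qed.

Lemma is_solutionE f x :
  is_solution alpha g f x <-> solves k g (path_ext f) (path_ext x).
Proof.
by split=> fx t t0; have := fx t t0; rewrite memoryE !path_ext_ge0.
Qed.

Lemma solution_solves f : solves k g (path_ext f) (sol f).
Proof.
apply/is_solutionE; apply: (xgetPex f).
have [x cx fx] := solution_exists kint K0 gK (@continuous_path_ext _ _ f).
exists (path_of cx); apply/is_solutionE => t t0.
rewrite path_ext_ge0// path_ofE// fx//; congr (_ + _).
apply/rowP => i; rewrite !mxE; apply: eq_Rintegral => s.
rewrite inE/= in_itv/= => /andP[s0 _].
by rewrite path_ext_ge0// path_ofE.
Qed.

(** tau is clamped so that the function is continuous for every real tau, which
    lets [translation] be defined without a condition on tau. *)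
Lemma continuous_translate tau f : continuous (fun theta =>
  path_ext f (Num.max tau 0 + theta) +
  volterra_rV k (g \o sol f) (Num.max tau 0 + Num.max theta 0) (Num.max tau 0)).
Proof.
move=> theta; apply: cvgD.
  apply: continuous_comp; last exact: continuous_path_ext.
  by apply: cvgD => //; exact: cvg_cst.
apply: continuous_volterra_rV_lag => //; last by rewrite le_max lexx orbT.
exact: (continuous_compg K0 gK (@continuous_path_ext _ _ _)).
Qed.

Definition translation tau f : cts_paths R d := path_of (@continuous_translate tau f).

Lemma path_translationE tau f theta : 0 <= tau -> 0 <= theta ->
  path_at (translation tau f) theta =
  path_at f (tau + theta) + volterra_rV k (g \o sol f) (tau + theta) tau.
Proof.
move=> tau0 theta0; rewrite /translation (path_ofE _ theta0).
have -> : Num.max tau 0 = tau by exact/max_idPl.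
have -> : Num.max theta 0 = theta by exact/max_idPl.
by rewrite (path_ext_ge0 _ (addr_ge0 tau0 theta0)).
Qed.

Lemma translationE tau f theta : 0 <= tau -> 0 <= theta ->
  path_at (translation tau f) theta = translate alpha g tau f theta.
Proof. by move=> tau0 theta0; rewrite path_translationE// /translate memoryE. Qed.

(** Both sides are continuous solutions for the forcing term T_tau f: on the
    right, the part of the integral up to tau is the memory term of T_tau f. *)
Lemma solution_translation tau f t : 0 <= tau -> 0 <= t ->
  sol (translation tau f) t = sol f (tau + t).
Proof.
move=> tau0; have cs : continuous (fun t => sol f (tau + t)).
  move=> s; apply: continuous_comp; last exact: continuous_path_ext.
  by apply: cvgD => //; exact: cvg_cst.
apply: (solution_unique kint K0 gK _ cs (solution_solves (translation tau f))).
  exact: continuous_path_ext.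
move=> s s0; rewrite solution_solves ?addr_ge0//.
rewrite (@volterra_rV_shift _ _ _ kint)//; first last.
- by rewrite s0 lexx.
- exact: (continuous_compg K0 gK (@continuous_path_ext _ _ _)).
rewrite [path_ext (translation _ _) _]path_ext_ge0// path_translationE//.
by rewrite addrA path_ext_ge0// addr_ge0.
Qed.

Lemma translation0 f : translation 0 f = f.
Proof.
apply: path_eq => t t0; rewrite path_translationE// add0r.
rewrite [X in _ + X](_ : _ = 0) ?addr0//; apply/rowP => i; rewrite !mxE.
by rewrite /volterra set_itvco0 Rintegral_set0.
Qed.

Lemma translationD sigma tau f : 0 <= sigma -> 0 <= tau ->
  translation (sigma + tau) f = translation sigma (translation tau f).
Proof.
move=> sigma0 tau0; apply: path_eq => t t0.
rewrite (path_translationE _ (addr_ge0 sigma0 tau0) t0).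
rewrite (path_translationE _ sigma0 t0).
rewrite (path_translationE _ tau0 (addr_ge0 sigma0 t0)).
have cg := continuous_compg K0 gK (@continuous_path_ext _ _ (solution alpha g f)).
have -> : sigma + tau + t = tau + (sigma + t) by rewrite addrCA addrA.
rewrite (addrC sigma tau) (@volterra_rV_shift _ _ _ kint)// ?sigma0 ?lerDl// addrA.
congr (_ + _); apply/rowP => i; rewrite !mxE; apply: eq_Rintegral => s.
rewrite inE/= in_itv/= => /andP[s0 _].
by rewrite /= solution_translation.
Qed.

(** With C the stability constant on [0, tau + N], paths that are
    e / (C + 1)-close on that interval have e-close translates on [0, N]: the
    values contribute e / (C + 1) and the memory terms at most C e / (C + 1). *)
Lemma continuous_translation tau : 0 <= tau -> continuous (translation tau).
Proof.
move=> tau0; apply: continuous_paths => f N e e0.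
have [C C0 stab] := solution_stability kint K0 gK (tau + N).
have C1 : 0 < C + 1 by rewrite ltr_pwDr.
have := @near_path _ _ f (tau + N) (e / (C + 1)); rewrite divr_gt0// => /(_ isT).
have nf : Filter (nbhs f) := @nbhs_filter (cts_paths R d) f.
apply: filterS => h fh t /andP[t0 tN].
have [_ mem] := stab _ _ _ _ _ (@continuous_path_ext _ _ _) (@continuous_path_ext _ _ _)
  (solution_solves f) (solution_solves h) (divr_ge0 (ltW e0) (ltW C1)) fh.
rewrite !path_ext_ge0// !path_translationE// opprD addrACA.
rewrite (le_trans (ler_normD _ _))//.
have -> : e = e / (C + 1) + C * (e / (C + 1)).
  by field; exact: lt0r_neq0.
rewrite lerD//.
  rewrite -!path_ext_ge0 ?addr_ge0//; apply: fh.
  by rewrite addr_ge0//= lerD2l.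
by apply: mem; rewrite ?tau0 ?lerDl ?lerD2l.
Qed.

End semiflow.

Theorem theorem4 (R : realType) (alpha : R) (d : nat)
    (g : 'rV[R]_d -> 'rV[R]_d)
    (alpha_gt0 : 0 < alpha) (alpha_lt1 : alpha < 1) (d_ge1 : (1 <= d)%N)
    (g_lipschitz : lipschitz g) :
  exists T : R -> cts_paths R d -> cts_paths R d,
    [/\ forall (tau : R) (f : cts_paths R d) (theta : R),
          0 <= tau -> 0 <= theta ->
          path_at (T tau f) theta = translate alpha g tau f theta,
        forall tau : R, 0 <= tau -> continuous (T tau),
        forall f : cts_paths R d, T 0 f = f
      & forall (sigma tau : R) (f : cts_paths R d),
          0 <= sigma -> 0 <= tau -> T (sigma + tau) f = T sigma (T tau f)].
Proof.
have [K K0 gK] : exists2 K : R, 0 <= K & forall u v, `|g u - g v| <= K * `|u - v|.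
  case: g_lipschitz => M [_ /(_ (`|M| + 1))]; rewrite (le_lt_trans (ler_norm _)) ?ltrDl//.
  move=> /(_ isT) gM; exists (`|M| + 1); first by rewrite addr_ge0.
  by move=> u v; exact: (gM (u, v)).
exists (@translation _ _ _ _ _ alpha_gt0 K0 gK); split.
- by move=> tau f theta tau0 theta0; exact: translationE.
- by move=> tau tau0; exact: continuous_translation.
- by move=> f; exact: translation0.
- by move=> sigma tau f sigma0 tau0; exact: translationD.
Qed.
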